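(* Let $G$ be a finite abelian group and let $S$ be a proper subset of $G$. If $\kappa(\mathrm{Cay}^+_G(S))<|S|$, then $$\kappa(\mathrm{Cay}^+_G(S))=\min\{|S+H|-|H| : H\le G,\ S+H\ne G\}.$$
   Context: For a subset $S$ of an abelian group $G$ (written additively), the addition Cayley graph $\mathrm{Cay}^+_G(S)$ is the undirected graph with vertex set $G$ in which $g_1,g_2$ are adjacent iff $g_1+g_2\in S$ (loops allowed). For a graph $\Gamma$ on a finite vertex set, $\kappa(\Gamma)$ is the smallest number of vertices whose removal leaves a graph that is disconnected or has only one vertex. $S+H=\{s+h:s\in S,h\in H\}$. *)

(* Defs.v *)
From mathcomp Require Import all_boot all_order all_algebra all_fingroup.

Set Implicit Arguments.
Unset Strict Implicit.
Unset Printing Implicit Defensive.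

Import GRing.Theory.
Local Open Scope nat_scope.

(* A graph on the vertex set T is a symmetric relation e : rel T, possibly    *)
(* with loops.                                                                *)

Definition induced (T : finType) (e : rel T) (A : {set T}) : rel T :=
  [rel x y | [&& x \in A, y \in A & e x y]].

Definition disconnected (T : finType) (e : rel T) (A : {set T}) : bool :=
  [exists x in A, exists y in A, ~~ connect (induced e A) x y].

Definition separating (T : finType) (e : rel T) (X : {set T}) : bool :=
  disconnected e (~: X) || (#|~: X| == 1).

(* On a nonempty T the default value #|T| is never attained, because the      *)
(* complement of a single vertex is separating; see kappaP.                   *)
Definition kappa (T : finType) (e : rel T) : nat :=
  \big[minn/#|T|]_(X : {set T} | separating e X) #|X|.

Definition is_min (P : nat -> Prop) (m : nat) : Prop :=
  P m /\ forall n, P n -> m <= n.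

Definition add_cayley (G : finZmodType) (S : {set G}) : rel G :=
  [rel x y | (x + y)%R \in S].

Definition sumset (G : finZmodType) (A B : {set G}) : {set G} :=
  [set (a + b)%R | a in A, b in B].

Lemma kappaP (T : finType) (e : rel T) : 0 < #|T| ->
  is_min (fun k => exists2 X : {set T}, separating e X & #|X| = k) (kappa e).
Proof.
case/card_gt0P=> t _.
have kleX (X : {set T}) : separating e X -> kappa e <= #|X|.
  move=> sX; rewrite /kappa.
  elim: (index_enum _) (mem_index_enum X) => //= Y r IHr.
  rewrite inE big_cons => /predU1P[<- | /IHr leX]; first by rewrite sX geq_minl.
  by case: ifP => // _; rewrite geq_min leX orbT.
split; last by move=> _ [X sX <-]; apply: kleX.
have s1 : separating e (~: [set t]) by rewrite /separating setCK cards1 orbT.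
have lt1 : #|~: [set t]| < #|T| 
  by rewrite cardsCs setCK cards1 subn1 ltn_predL;
  apply/card_gt0P; exists t.
have : kappa e = #|T| \/ exists2 X : {set T}, separating e X & #|X| = kappa e.
  rewrite /kappa; elim/big_ind: _ => [|m n IHm IHn|X sX]; first by left.
    by case: (leqP m n).
  by right; exists X.
by case=> // kT; have := kleX _ s1; rewrite kT leqNgt lt1.
Qed.

Lemma add_cayley_sym (G : finZmodType) (S : {set G}) :
  symmetric (add_cayley S).
Proof. by move=> x y; rewrite /add_cayley /= addrC. Qed.

(* {group G} is the type of additive subgroups: the group law carried by a    *)
(* finZmodType is its addition.                                               *)
Lemma group_setE (G : finZmodType) (A : {set G}) :
  group_set A <-> (0%R \in A /\ {in A &, forall x y, (x + y)%R \in A}).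
Proof. by split=> [/group_setP[] | []] // *; apply/group_setP. Qed.

(* The truncated subtraction #|sumset S H| - #|H| is exact when S is          *)
(* nonempty.                                                                  *)
Lemma leq_card_sumset (G : finZmodType) (S : {set G}) (H : {group G}) :
  S != set0 -> #|H| <= #|sumset S H|.
Proof.
case/set0Pn=> s sS; rewrite -(card_imset (mem H) (addrI s)).
by apply/subset_leq_card/subsetP=> _ /imsetP[h hH ->]; apply: imset2_f.
Qed.

(* Main.v *)
Require Import Defs.
From mathcomp Require Import all_boot all_order all_algebra all_fingroup.
From mathcomp Require Import zify.

(* A vertex cut of size k amounts to disjoint nonempty sets A, B with A + B   *)
(* disjoint from S and |A| + |B| = |G| - k.  By Kneser's theorem A + B is a   *)
(* union of cosets of a subgroup K with |A| + |B| <= |A + B| + |K|, and S + K *)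
(* misses A + B; hence |S + K| - |K| <= k.                                    *)
(* For the converse, let k = kappa < |S|, suppose |S + H| - |H| < k for some  *)
(* H with S + H <> G, take |H| minimal and put D = S + H, h = |H|.  For t < h *)
(* let U_t, V_t be the unions of the H-cosets containing more than t elements *)
(* of A, resp. at least h - t elements of B.  By the pigeonhole principle     *)
(* (U_t, V_t) is again a cut when both are nonempty, whence                   *)
(* |U_t| + |V_t| <= |G| - k < |G| - |D| + h, so <= |G| - |D| by divisibility. *)
(* Summing over t bounds |A| + |B|; the levels where U_t or V_t is empty are  *)
(* controlled by Kneser's theorem applied to the largest coset fiber of A or  *)
(* B, and the resulting bound contradicts |A| + |B| = |G| - k.                *)

(** Both inequalities use [kneser] through [periodic_avoid]. For the lower bound on |S + H| - |H|,
    [ex_kappa_cut] supplies a cut with k + |A| + |B| = |G|, while [card_cut_lt] shows that a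
    violating H of least order would make this inequality strict for every cut. Minimality enters
    through [card_sumset_incomparable]: two violating subgroups with incomparable sumsets would have
    a violating intersection. From it comes [card_neighbors_fiber], which together with
    [card_neighbors] bounds the y in B with x + y in D for a fixed x in A, and so closes the count
    over the levels t. *)

Set Implicit Arguments.
Unset Strict Implicit.
Unset Printing Implicit Defensive.

Import GRing.Theory.
Local Open Scope nat_scope.

(** * Unions of cosets *)

Section Subgroups.

Variable G : finZmodType.
Implicit Types (A B C D P Q S T : {set G}) (H K : {group G}) (x y z : G).

Lemma subg0 H : 0%R \in H. Proof. exact: group1. Qed.

Lemma subgD H x y : x \in H -> y \in H -> (x + y)%R \in H.
Proof. exact: groupM. Qed.

Lemma subgN H x : (- x)%R \in H = (x \in H).
Proof. exact: groupV. Qed.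

Lemma subgB H x y : x \in H -> y \in H -> (x - y)%R \in H.
Proof. by move=> xH yH; rewrite subgD ?subgN. Qed.

Lemma subgDr H x y : y \in H -> ((x + y)%R \in H) = (x \in H).
Proof. exact: groupMr. Qed.

Lemma mem_sumset A B x y : x \in A -> y \in B -> (x + y)%R \in sumset A B.
Proof. exact: imset2_f. Qed.

Definition periodic (H : {set G}) C :=
  {in C & H, forall x y, (x + y)%R \in C}.

Lemma periodic_sumset A H : periodic H (sumset A H).
Proof.
move=> _ y /imset2P[a x aA xH ->] yH.
by rewrite -addrA mem_sumset ?subgD.
Qed.

Lemma sub_sumset A H : A \subset sumset A H.
Proof. by apply/subsetP=> a aA; rewrite -[a]addr0 mem_sumset ?subg0. Qed.

Lemma periodicE H C x y : periodic H C -> y \in H ->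
  ((x + y)%R \in C) = (x \in C).
Proof.
move=> perC yH; apply/idP/idP=> [xyC | /perC->//].
by rewrite -[x](addrK y) perC // subgN.
Qed.

Lemma periodicE_sub H C x y : periodic H C -> (x - y)%R \in H ->
  (x \in C) = (y \in C).
Proof. by move=> perC xyH; rewrite -(periodicE y perC xyH) addrC subrK. Qed.

Lemma periodicC H C : periodic H C -> periodic H (~: C).
Proof. by move=> perC x y; rewrite !inE => nCx yH; rewrite (periodicE _ perC). Qed.

Lemma periodicU H C D : periodic H C -> periodic H D -> periodic H (C :|: D).
Proof. by move=> pC pD x y xCD yH; rewrite inE !(periodicE _ _ yH) // -in_setU. Qed.

Lemma periodicI H C D : periodic H C -> periodic H D -> periodic H (C :&: D).
Proof. by move=> pC pD x y xCD yH; rewrite inE !(periodicE _ _ yH) // -in_setI. Qed.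

Lemma periodicS H K C : K \subset H -> periodic H C -> periodic K C.
Proof. by move=> sKH perC x y xC /(subsetP sKH); apply: perC. Qed.

Lemma card_translate A x : #|[set (x + a)%R | a in A]| = #|A|.
Proof. exact/card_imset/addrI. Qed.

Lemma leq_card_translate A B x : {in A, forall a, (x + a)%R \in B} -> #|A| <= #|B|.
Proof.
move=> sAB; rewrite -(card_translate A x); apply/subset_leq_card.
by apply/subsetP=> _ /imsetP[a aA ->]; apply: sAB.
Qed.

Lemma periodic_leq_card H C x : periodic H C -> x \in C -> #|H| <= #|C|.
Proof.
by move=> perC xC; apply: (@leq_card_translate _ _ x) => y yH; apply: perC.
Qed.

Lemma periodic_dvdn H C : periodic H C -> #|H| %| #|C|.
Proof.
have [n] := ubnP #|C|; elim: n C => // n IHn C ltCn perC.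
have [->|[x xC]] := set_0Vmem C; first by rewrite cards0 dvdn0.
pose X := [set (x + y)%R | y in H].
have sXC : X \subset C by apply/subsetP=> _ /imsetP[y yH ->]; apply: perC.
have cX : #|X| = #|H| by apply: card_translate.
have perX : periodic H X.
  by move=> _ y /imsetP[z zH ->] yH; rewrite -addrA imset_f ?subgD.
have cCX := cardsD C X; rewrite (setIidPr sXC) cX in cCX.
have H_gt0 := cardG_gt0 H; have leHC := periodic_leq_card perC xC.
rewrite -(dvdn_subl leHC (dvdnn _)) -cCX IHn ?cCX //; first by lia.
by rewrite setDE; apply: periodicI => //; apply: periodicC.
Qed.

(** Each sum has at most [#|H :&: K|] representations: if c + d = a + b, then c - a = b - d lies in
    both subgroups, and c determines d. *)
Lemma leq_mul_card_sumset H K P Q : P \subset H -> Q \subset K ->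
  #|P| * #|Q| <= #|sumset P Q| * #|H :&: K|.
Proof.
move=> sPH sQK; rewrite -cardsX.
pose f (u : G * G) := (u.1 + u.2)%R.
rewrite -sum1_card (partition_big f (mem (sumset P Q))) /=; last first.
  by case=> a b /setXP[aP bQ]; apply: mem_sumset.
rewrite -sum_nat_const; apply: leq_sum => _ /imset2P[a b aP bQ ->].
rewrite sum1dep_card.
set F := [set _ | _]; rewrite -(card_in_imset (f := fun u : G * G => (u.1 - a)%R) (D := F)).
  apply/subset_leq_card/subsetP => _ /imsetP[[c d] /= + ->].
  rewrite inE => /andP[/setXP[cP dQ] /eqP eqf].
  have e : (c - a = b - d)%R.
    by apply/eqP; rewrite subr_eq addrAC eq_sym subr_eq [eqbLHS]addrC -eqf.
  by rewrite inE {2}e !subgB // ?(subsetP sPH) ?(subsetP sQK).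
move=> [c d] [c' d']; rewrite !inE /f /= => /andP[_ /eqP e1] /andP[_ /eqP e2] /addIr ec.
by move: e1; rewrite -e2 ec => /addrI ->.
Qed.

End Subgroups.

(** * Kneser's theorem *)

(** When all four parts are at least m, m(q + p' - m) <= qp' and m(q' + p - m) <= q'p, and adding
    the resulting bounds gives one of the first two alternatives. The third is there for p = 0,
    where only h2 <= d21 is available. *)
Lemma grid_arith m h1 h2 q q' p p' d21 d12 : 0 < m ->
    q + q' = h1 -> p + p' = h2 -> m <= q -> m <= p' ->
    p = 0 \/ m <= p -> q' = 0 \/ m <= q' ->
    q * p' <= d21 * m -> q' * p <= d12 * m ->
  h1 <= d21 + m \/ h2 <= d12 + m \/ h2 < h1.
Proof.
move=> m_gt0 eh1 eh2 leq lep' dp dq' le21 le12.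
case: dq' => [q'0|leq'].
  have : q * m <= d21 * m by apply: leq_trans le21; rewrite leq_mul2l lep' orbT.
  by rewrite leq_pmul2r //; lia.
case: dp => [p0|lep].
  have : m * p' <= m * d21.
    by rewrite [m * d21]mulnC; apply: leq_trans le21; rewrite leq_mul2r leq orbT.
  by rewrite leq_pmul2l //; lia.
have [|lt1] := leqP h1 (d21 + m); first by left.
have [|lt2] := leqP h2 (d12 + m); first by right; left.
exfalso.
have e1 : m * (q + p' - m) <= m * d21 by nia.
have e2 : m * (q' + p - m) <= m * d12 by nia.
rewrite !leq_pmul2l // in e1 e2; lia.
Qed.

Section Kneser.

Variable G : finZmodType.
Implicit Types (A B C D P Q S T : {set G}) (H K : {group G}) (x y z : G).

(* Inside the coset y + H1 + H2, membership in C1 (in C2) depends only on the *)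
(* H2-component (the H1-component), so both differences are rectangles.       *)
Lemma card_periodic_diff H1 H2 C1 C2 y :
    periodic H1 C1 -> periodic H2 C2 -> y \in C2 :\: C1 ->
  [\/ #|H1| <= #|C2 :\: C1| + #|H1 :&: H2|,
      #|H2| <= #|C1 :\: C2| + #|H1 :&: H2| | #|H2| < #|H1|].
Proof.
move=> per1 per2 /setDP[yC2 nyC1].
pose Q := [set a in H1 | (y + a)%R \in C2].
pose P := [set b in H2 | (y + b)%R \in C1].
have memg a b : a \in H1 -> b \in H2 ->
    (((y + (a + b))%R \in C1) = ((y + b)%R \in C1)) *
    (((y + (a + b))%R \in C2) = ((y + a)%R \in C2)).
  move=> aH1 bH2; split; last by rewrite addrA [LHS](periodicE _ per2).
  by rewrite [(a + b)%R]addrC addrA [LHS](periodicE _ per1).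
have sQ : Q \subset H1 by apply/subsetP=> a /setIdP[].
have sP : P \subset H2 by apply/subsetP=> a /setIdP[].
have le21 : #|Q| * #|H2 :\: P| <= #|C2 :\: C1| * #|H1 :&: H2|.
  apply: leq_trans (leq_mul_card_sumset sQ (subsetDl _ _)) _.
  rewrite leq_mul2r (@leq_card_translate _ _ _ y) ?orbT //.
  move=> _ /imset2P[a b /setIdP[aH1 yaC2] /setDP[bH2 nPb] ->].
  by rewrite inE !memg // yaC2 andbT; apply: contra nPb; rewrite inE bH2.
have le12 : #|H1 :\: Q| * #|P| <= #|C1 :\: C2| * #|H1 :&: H2|.
  apply: leq_trans (leq_mul_card_sumset (subsetDl _ _) sP) _.
  rewrite leq_mul2r (@leq_card_translate _ _ _ y) ?orbT //.
  move=> _ /imset2P[a b /setDP[aH1 nQa] /setIdP[bH2 ybC1] ->].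
  by rewrite inE !memg // ybC1 andbT; apply: contra nQa; rewrite inE aH1.
have perM1 := periodicS (subsetIl H1 H2) per1.
have perM2 := periodicS (subsetIr H1 H2) per2.
have leQ : #|H1 :&: H2| <= #|Q|.
  apply/subset_leq_card/subsetP=> a aM; have /setIP[aH1 _] := aM.
  by rewrite inE aH1 (periodicE _ perM2).
have leP' : #|H1 :&: H2| <= #|H2 :\: P|.
  apply/subset_leq_card/subsetP=> a aM; have /setIP[_ aH2] := aM.
  by rewrite !inE aH2 (periodicE _ perM1) // (negPf nyC1).
have leP : #|P| = 0 \/ #|H1 :&: H2| <= #|P|.
  have [->|[b /setIdP[bH2 ybC1]]] := set_0Vmem P; first by left; rewrite cards0.
  right; apply: (@leq_card_translate _ _ _ b) => c cM; have /setIP[_ cH2] := cM.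
  by rewrite inE subgD // addrA (periodicE _ perM1).
have leQ' : #|H1 :\: Q| = 0 \/ #|H1 :&: H2| <= #|H1 :\: Q|.
  have [->|[a /setDP[aH1 nQa]]] := set_0Vmem (H1 :\: Q); first by left; rewrite cards0.
  right; apply: (@leq_card_translate _ _ _ a) => c cM; have /setIP[cH1 _] := cM.
  by rewrite 2!inE subgD // addrA (periodicE _ perM2) // andbT; rewrite inE aH1 in nQa.
have cQ : #|Q| + #|H1 :\: Q| = #|H1| by rewrite -(cardsID Q H1) (setIidPr sQ).
have cP : #|P| + #|H2 :\: P| = #|H2| by rewrite -(cardsID P H2) (setIidPr sP).
have m_gt0 : 0 < #|H1 :&: H2| by rewrite cardG_gt0.
have [|[|]] := grid_arith m_gt0 cQ cP leQ leP' leP leQ' le21 le12.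
- by constructor 1.
- by constructor 2.
- by constructor 3.
Qed.

(** [card_periodic_diff] applies to both differences, and its exceptional alternatives
    [#|H2| < #|H1|] and [#|H1| < #|H2|] exclude each other. *)
Lemma card_periodicU H1 H2 C1 C2 :
    periodic H1 C1 -> periodic H2 C2 -> ~~ (C1 \subset C2) -> ~~ (C2 \subset C1) ->
  #|C1| + #|H1| <= #|C1 :|: C2| + #|H1 :&: H2| \/
  #|C2| + #|H2| <= #|C1 :|: C2| + #|H1 :&: H2|.
Proof.
move=> per1 per2 /subsetPn[z zC1 nzC2] /subsetPn[y yC2 nyC1].
have y21 : y \in C2 :\: C1 by rewrite inE nyC1.
have z12 : z \in C1 :\: C2 by rewrite inE nzC2.
have cU : #|C1 :|: C2| = #|C1| + #|C2 :\: C1|.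
  by rewrite cardsU cardsD [C2 :&: C1]setIC addnBA ?subset_leq_card ?subsetIr.
have cU' : #|C1 :|: C2| = #|C2| + #|C1 :\: C2|.
  by rewrite cardsU cardsD addnBA ?[#|C2| + _]addnC // subset_leq_card ?subsetIl.
case: (card_periodic_diff per1 per2 y21);
  case: (card_periodic_diff per2 per1 z12); rewrite ?[H2 :&: H1]setIC; lia.
Qed.

(* Dyson's e-transform: replacing (A, B) by                                   *)
(* (A :|: (B + a - b), B :&: (A - a + b)) preserves #|A| + #|B| and keeps b   *)
(* in the second set; when it never shrinks B, the set A is a union of cosets *)
(* of the subgroup generated by B - b.                                        *)
Lemma kneser_translate A B b : A != set0 -> b \in B ->
  exists2 D : {set G}, {in A, forall a, (a + b)%R \in D} /\ D \subset sumset A B &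
    exists2 H : {group G}, periodic H D & #|A| + #|B| <= #|D| + #|H|.
Proof.
have [n] := ubnP #|B|; elim: n A B => // n IHn A B ltBn A0 bB.
have [clA|] := boolP [forall a in A, forall c in B, (a - b + c)%R \in A].
  pose X := [set (c - b)%R | c in B]; pose H := (<<X>>)%G.
  have perX a x : a \in A -> x \in X -> (a + x)%R \in A.
    move=> aA /imsetP[c cB ->]; rewrite addrCA addrC -addrAC.
    by move/forall_inP: clA => /(_ a aA) /forall_inP/(_ c cB); rewrite -!addrA [(- b + c)%R]addrC.
  have perA : periodic H A.
    move=> a x aA /gen_prodgP[k [c cX ->]].
    elim: k c cX => [|k IHk] c cX; first by rewrite big_ord0 [(_ + _)%R]addr0.
    rewrite big_ord_recr /= [(_ + _)%R]addrA; apply: perX => //.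
    by apply: IHk => i.
  exists [set (b + a)%R | a in A].
    split=> [a aA|]; first by rewrite addrC; apply: imset_f.
    by apply/subsetP=> _ /imsetP[a aA ->]; rewrite addrC mem_sumset.
  exists H.
    by move=> _ y /imsetP[a aA ->] yH; rewrite -addrA; apply/imset_f/perA.
  rewrite card_translate leq_add2l (@leq_card_translate _ _ _ (- b)%R) // => c cB.
  by apply: mem_gen; rewrite addrC; apply: imset_f.
rewrite negb_forall => /existsP[a]; rewrite negb_imply => /andP[aA].
rewrite negb_forall => /existsP[c]; rewrite negb_imply => /andP[cB nA].
(* The e-transform by a - b: b stays in [B1] because a - b + b = a, while c drops out. *)
pose X := [set (a - b + d)%R | d in B].
pose A1 := A :|: X; pose B1 := [set d in B | (a - b + d)%R \in A].
have cB1 : #|B1| = #|A :&: X|.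
  rewrite -(card_translate B1 (a - b)%R); apply: eq_card => x.
  apply/imsetP/setIP=> [[d /setIdP[dB adA] ->]|[xA /imsetP[d dB ex]]].
    by split=> //; apply: imset_f.
  by exists d => //; rewrite inE dB -ex.
have card1 : #|A1| + #|B1| = #|A| + #|B|.
  by rewrite cB1 cardsUI card_translate.
have ltB1 : #|B1| < #|B|.
  apply: proper_card; apply/properP; split; first by apply/subsetP=> d /setIdP[].
  by exists c => //; rewrite inE (negPf nA) andbF.
have A10 : A1 != set0.
  by apply/set0Pn; exists a; rewrite inE aA.
have bB1 : b \in B1 by rewrite inE bB subrK.
have [D [sAD sD] [H perD leD]] := IHn A1 B1 (leq_trans ltB1 ltBn) A10 bB1.
exists D; last by exists H => //; rewrite -card1.
split=> [x xA|]; first by apply: sAD; rewrite inE xA.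
apply: subset_trans sD _; apply/subsetP=> _ /imset2P[x d + /setIdP[dB adA] ->].
case/setUP=> [xA|/imsetP[e eB ->]]; first exact: mem_sumset.
by rewrite addrAC; apply: mem_sumset.
Qed.

(** [kneser_translate] covers each A + b by a periodic piece of A + B satisfying the bound. Pieces
    are joined one b at a time: of two nested pieces the larger serves, and for incomparable ones
    [card_periodicU] carries the bound to the union, with the intersection of the subgroups. *)
Theorem kneser A B : A != set0 -> B != set0 ->
  exists2 H : {group G}, periodic H (sumset A B) &
    #|A| + #|B| <= #|sumset A B| + #|H|.
Proof.
move=> A0 B0.
suff main E : E != set0 -> E \subset B ->
  exists2 D : {set G}, sumset A E \subset D /\ D \subset sumset A B &
    exists2 H : {group G}, periodic H D & #|A| + #|B| <= #|D| + #|H|.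
  have [D [sAB sD] [H perD leD]] := main B B0 (subxx _).
  have eD : D = sumset A B by apply/eqP; rewrite eqEsubset sD.
  by exists H; rewrite -eD.
have [n] := ubnP #|E|; elim: n E => // n IHn E ltEn /set0Pn[b bE] sEB.
have [D2 [sD2 sD2'] [H2 perD2 leD2]] := kneser_translate A0 (subsetP sEB b bE).
have [E1|E1] := eqVneq (E :\ b) set0.
  exists D2; last by exists H2.
  split=> //; apply/subsetP=> _ /imset2P[a c aA cE ->].
  have : c \notin E :\ b by rewrite E1 inE.
  by rewrite !inE cE andbT negbK => /eqP->; apply: sD2.
have cE := cardsD1 b E; rewrite bE in cE.
have ltE1n : #|E :\ b| < n by lia.
have sE1B : E :\ b \subset B := subset_trans (subD1set _ _) sEB.
have [D1 [sD1 sD1'] [H1 perD1 leD1]] := IHn _ ltE1n E1 sE1B.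
have sU : sumset A E \subset D1 :|: D2.
  apply/subsetP=> _ /imset2P[a c aA cE' ->]; rewrite inE.
  have [->|cb] := eqVneq c b; first by rewrite sD2 ?orbT.
  by rewrite (subsetP sD1) ?mem_sumset // !inE cb.
have [s12|n12] := boolP (D1 \subset D2).
  by exists D2; [split=> //; rewrite -(setUidPr s12) | exists H2].
have [s21|n21] := boolP (D2 \subset D1).
  by exists D1; [split=> //; rewrite -(setUidPl s21) | exists H1].
exists (D1 :|: D2); first by split=> //; rewrite subUset sD1'.
exists (H1 :&: H2)%G.
  by apply: periodicU; [apply: periodicS perD1; apply: subsetIl |
                        apply: periodicS perD2; apply: subsetIr].
by case: (card_periodicU perD1 perD2 n12 n21) => leU; apply: leq_trans leU.
Qed.

(** The complement of A + B contains S and is a union of K-cosets, so it contains S + K. *)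
Lemma periodic_avoid A B S : A != set0 -> B != set0 ->
    {in A & B, forall a b, (a + b)%R \notin S} ->
  exists2 K : {group G}, {in A & B, forall a b, (a + b)%R \notin sumset S K} &
    #|sumset S K| + #|A| + #|B| <= #|[set: G]| + #|K|.
Proof.
move=> A0 B0 avS; have [K perK leK] := kneser A0 B0.
have avK : sumset S K \subset ~: sumset A B.
  apply/subsetP=> _ /imset2P[s k sS kK ->].
  rewrite inE (periodicE _ perK) //; apply/imset2P=> -[a b aA bB es].
  by have := avS a b aA bB; rewrite -es sS.
exists K => [a b aA bB|].
  by apply/negP=> /(subsetP avK); rewrite inE mem_sumset.
have := subset_leq_card avK; have := cardsC (sumset A B); rewrite -cardsT; lia.
Qed.

End Kneser.

(** * Vertex cuts *)

Section Cuts.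

Variables (T : finType) (e : rel T).
Implicit Types A B X : {set T}.

Lemma kappa_cut A B : A != set0 -> B != set0 -> [disjoint A & B] ->
  {in A & B, forall x y, ~~ e x y} -> kappa e + #|A| + #|B| <= #|T|.
Proof.
move=> /set0Pn[a aA] /set0Pn[b bB] dAB nAB.
have T_gt0 : 0 < #|T| by apply/card_gt0P; exists a.
have sepX : separating e (~: (A :|: B)).
  apply/orP; left; rewrite setCK; apply/existsP; exists a; rewrite inE aA /=.
  apply/existsP; exists b; rewrite inE bB orbT /=; apply/negP=> /connectP[p + eb].
  have {eb} : last a p \notin A by rewrite -eb (disjointFl dAB bB).
  elim: p a aA => [|c p IHp] a aA /=; first by rewrite aA.
  move=> nl /andP[/and3P[_ cAB eac]]; apply: IHp => //.
  by case/setUP: cAB => // cB; rewrite (negPf (nAB _ _ aA cB)) in eac.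
have le_k : kappa e <= #|~: (A :|: B)|.
  by apply: (kappaP e T_gt0).2; exists (~: (A :|: B)).
have := cardsC (A :|: B); have := cardsUI A B.
by rewrite disjoint_setI0 // cards0; lia.
Qed.

(** At least two vertices survive an optimal removal, so the rest is disconnected; A is what one
    vertex reaches there and B what remains. *)
Lemma ex_kappa_cut : (kappa e).+1 < #|T| ->
  exists A B, [/\ A != set0, B != set0, [disjoint A & B],
    {in A & B, forall x y, ~~ e x y} & kappa e + #|A| + #|B| = #|T|].
Proof.
move=> lt_kT; have T_gt0 : 0 < #|T| by lia.
have [[X sepX cX] _] := kappaP e T_gt0.
have cCX := cardsC X; case/orP: sepX => [|/eqP c1]; last by lia.
case/existsP=> x /andP[nXx] /existsP[y /andP[nXy ncxy]].
pose A := [set z in ~: X | connect (induced e (~: X)) x z].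
have sAX : A \subset ~: X by apply/subsetP=> z /setIdP[].
exists A, (~: X :\: A); split.
- by apply/set0Pn; exists x; rewrite inE nXx connect0.
- by apply/set0Pn; exists y; rewrite inE nXy andbT inE negb_and ncxy orbT.
- rewrite disjoint_subset; apply/subsetP=> z zA.
  by apply/negP=> /setDP[_ /negP]; apply.
- move=> a b aA /setDP[nXb]; apply: contra => eab.
  have /setIdP[nXa cxa] := aA.
  rewrite inE nXb; apply: connect_trans cxa (connect1 _).
  by apply/and3P.
- have := cardsID A (~: X); rewrite (setIidPr sAX); lia.
Qed.

End Cuts.

(** * Summation by superlevel sets *)

Lemma sum_ord_interval h m n :
  \sum_(t < h) (m <= t < n) = minn h n - m.
Proof.
elim: h => [|h IHh]; first by rewrite big_ord0 min0n.
by rewrite big_ord_recr /= IHh; lia.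
Qed.

Lemma sum_card_superlevel (I : finType) (D : {set I}) (f : I -> nat) h :
    (forall x, f x <= h) ->
  \sum_(t < h) #|[set x in D | t < f x]| = \sum_(x in D) f x.
Proof.
move=> le_fh; transitivity (\sum_(t < h) \sum_(x in D) (0 <= t < f x : nat)).
  apply: eq_bigr => t _; rewrite -sum1dep_card big_mkcondr /=.
  by apply: eq_bigr => x _; case: (_ < _).
rewrite exchange_big; apply: eq_bigr => x _.
by rewrite sum_ord_interval subn0; apply/minn_idPr.
Qed.

Lemma sum_card_superlevel_rev (I : finType) (D : {set I}) (f : I -> nat) h :
    (forall x, f x <= h) ->
  \sum_(t < h) #|[set x in D | h - t <= f x]| = \sum_(x in D) f x.
Proof.
move=> le_fh; rewrite -(sum_card_superlevel D le_fh).
rewrite (reindex_inj rev_ord_inj); apply: eq_bigr => t _.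
by apply: eq_card => x; rewrite !inE /= subKn.
Qed.

(** * Coset fibers *)

Section Fibers.

Variable G : finZmodType.
Implicit Types (A B C D P Q S T : {set G}) (H K : {group G}) (x y z : G).

Definition fiber H A x := #|[set a in A | (a - x)%R \in H]|.

Lemma leq_fiber H A x : fiber H A x <= #|H|.
Proof.
apply: (@leq_card_translate _ _ _ (- x)%R) => a /setIdP[_].
by rewrite addrC.
Qed.

Lemma fiberD H A x y : y \in H -> fiber H A (x + y)%R = fiber H A x.
Proof.
move=> yH; apply: eq_card => a; rewrite !inE opprD addrA.
by rewrite (subgDr _ (y := (- y)%R)) ?subgN.
Qed.

Lemma sum_fiber H A D : periodic H D ->
  \sum_(x in D) fiber H A x = #|H| * #|A :&: D|.
Proof.
move=> perD; transitivity (\sum_(x in D) \sum_(a in A | (a - x)%R \in H) 1).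
  by apply: eq_bigr => x _; rewrite sum1dep_card.
rewrite (exchange_big_dep (mem A)) /=; last by move=> x a _ /andP[].
rewrite mulnC -sum_nat_const (eq_bigl _ _ (fun a => in_setI a A D)) big_mkcondr.
apply: eq_bigr => a aA; rewrite sum1dep_card aA.
have [aD|naD] := boolP (a \in D).
  rewrite -(card_imset (mem H) (inj_comp (addrI a) oppr_inj)).
  apply: eq_card => x; rewrite inE; apply/andP/imsetP=> [[xD axH]|[y yH ->]].
    by exists (a - x)%R; rewrite //= opprB addrC subrK.
  by rewrite perD ?subgN //= opprB addrC subrK.
apply: eq_card0 => x; rewrite inE; apply: contraNF naD => /andP[xD axH].
by rewrite (periodicE_sub perD axH).
Qed.

Lemma sum_superlevel_fiber H A D : periodic H D ->
  \sum_(t < #|H|) #|[set x in D | t < fiber H A x]| = #|H| * #|A :&: D|.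
Proof.
move=> perD.
exact: etrans (sum_card_superlevel D (leq_fiber H A)) (sum_fiber A perD).
Qed.

Lemma sum_superlevel_fiber_rev H A D : periodic H D ->
  \sum_(t < #|H|) #|[set x in D | #|H| - t <= fiber H A x]| = #|H| * #|A :&: D|.
Proof.
move=> perD.
exact: etrans (sum_card_superlevel_rev D (leq_fiber H A)) (sum_fiber A perD).
Qed.

(** For s in S with x + y in s + H, the part of A in x + H and the reflections s - b of the part of
    B in y + H share the coset x + H, so they meet in some a = s - b. *)
Lemma fiber_pigeonhole H A B S x y : (x + y)%R \in sumset S H ->
    #|H| < fiber H A x + fiber H B y ->
  exists a b, [/\ a \in A, b \in B & (a + b)%R \in S].
Proof.
case/imset2P=> s k sS kH exy lt_h.
pose P := [set a in A | (a - x)%R \in H].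
pose Q := [set (s - b)%R | b in [set b in B | (b - y)%R \in H]].
have cQ : #|Q| = fiber H B y by apply: card_imset => b c /addrI/oppr_inj.
have sU : #|P :|: Q| <= #|H|.
  apply: (@leq_card_translate _ _ _ (- x)%R) => a; rewrite addrC.
  case/setUP=> [/setIdP[]//|/imsetP[b /setIdP[_ byH] ->]].
  have -> : (s - b - x = - (b - y) - k)%R.
    have -> : s = (x + y - k)%R by rewrite exy addrK.
    by rewrite opprB -!addrA [LHS]addrC -!addrA addNr addr0 [(- k - b)%R]addrC.
  by rewrite subgB ?subgN.
have : P :&: Q != set0.
  rewrite -card_gt0; have := cardsUI P Q; rewrite cQ; rewrite /fiber -/P in lt_h *; lia.
case/set0Pn=> a /setIP[/setIdP[aA _] /imsetP[b /setIdP[bB _] ea]].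
by exists a, b; rewrite ea subrK; rewrite ea in aA.
Qed.

End Fibers.

(** * Subgroups violating the lower bound *)

Section MinimalSubgroup.

Variables (G : finZmodType) (S : {set G}) (k : nat) (H : {group G}).
Implicit Types (A B D : {set G}) (K : {group G}) (x y : G).

Let D := sumset S H.

(* k stands for the vertex connectivity of the addition Cayley graph of S.    *)
Hypothesis lt_kS : k < #|S|.
Hypothesis properD : D != [set: G].
Hypothesis lt_Dk : #|D| < k + #|H|.
Hypothesis minH : forall K,
  sumset S K != [set: G] -> #|sumset S K| < k + #|K| -> #|H| <= #|K|.

(** If K also violated the bound, [card_periodicU] on the complements of D and S + K would make
    [H :&: K] violate it, so by minimality H would lie in K and D in S + K. *)
Lemma card_sumset_incomparable K :
    sumset S K != [set: G] -> ~~ (D \subset sumset S K) ->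
  k + #|K| <= #|sumset S K|.
Proof.
move=> properC nDC; rewrite leqNgt; apply/negP=> lt_Ck.
set C := sumset S K in properC nDC lt_Ck.
have leHK := minH properC lt_Ck.
have perD : periodic H D by apply: periodic_sumset.
have perC : periodic K C by apply: periodic_sumset.
(* If C were inside D, then D would be a union of K-cosets and D \ C would contain one, so that |D|
   >= |S| + |K| > k + |H|. *)
have nCD : ~~ (C \subset D).
  apply/negP=> sCD; have [p pD npC] := subsetPn nDC.
  have perKD : periodic K D.
    move=> _ y /imset2P[s h sS hH ->] yK.
    by rewrite addrAC perD // (subsetP sCD) // mem_sumset.
  have pDC : p \in D :&: ~: C by rewrite !inE pD.
  have leK := periodic_leq_card (periodicI perKD (periodicC perC)) pDC.
  have leSC : #|S| <= #|C| by apply/subset_leq_card/sub_sumset.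
  have := cardsID C D; rewrite (setIidPr sCD) setDE; lia.
have := card_periodicU (periodicC perD) (periodicC perC).
rewrite !setCS => /(_ nCD nDC) leU.
pose M := (H :&: K)%G; pose E := sumset S M.
have sED : E \subset D by apply: imset2S; rewrite // subsetIl.
have sEC : E \subset C by apply: imset2S; rewrite // subsetIr.
have properE : E != [set: G].
  by apply: contraNneq properD => eE; rewrite -subTset -eE.
have sEU : ~: D :|: ~: C \subset ~: E by rewrite -setCI setCS subsetI sED.
have ltE : #|E| < k + #|M|.
  have := subset_leq_card sEU; have := cardsC E; have := cardsC D.
  have cM : #|M| = #|H :&: K| by [].
  have := cardsC C; rewrite cM; lia.
have leHM := minH properE ltE.
have /eqP eM : H :&: K == H by rewrite eqEcard subsetIl leHM.
case/negP: nDC; apply: imset2S => //; exact/setIidPl.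
Qed.

(* Kneser's theorem applied to the fiber of A in x + H and the set of all y   *)
(* that are in B or have x + y outside D.                                     *)
Lemma card_neighbors_fiber A B x :
    {in A & B, forall a b, (a + b)%R \notin S} -> x \in A ->
  [set y in B | (x + y)%R \in D] = set0 \/
  k + fiber H A x + #|[set y in B | (x + y)%R \in D]| <= #|D|.
Proof.
move=> avS xA; set E := [set y in B | _]; have [->|[b bE]] := set_0Vmem E; [by left | right].
pose A0 := [set a in A | (a - x)%R \in H].
pose F := [set y | (x + y)%R \in ~: D].
have perD : periodic H D by apply: periodic_sumset.
have xA0 : x \in A0 by rewrite inE xA subrr subg0.
have bEF : b \in E :|: F by rewrite inE bE.
have av0 : {in A0 & E :|: F, forall a c, (a + c)%R \notin S}.
  move=> a c /setIdP[aA axH] /setUP[/setIdP[cB _]|]; first exact: avS.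
  rewrite !inE; apply: contra => /(subsetP (sub_sumset S H)).
  by rewrite (@periodicE_sub _ H D _ (x + c)%R) // opprD addrACA subrr addr0.
have cF : #|F| = #|~: D|.
  rewrite -(card_translate F x); apply: eq_card => z.
  apply/imsetP/idP=> [[y yF ->]|zD]; first by rewrite inE in yF.
  by exists (z - x)%R; rewrite ?inE addrCA subrr addr0 -?in_setC.
have dEF : E :&: F = set0.
  apply/eqP; rewrite -subset0; apply/subsetP=> y /setIP[/setIdP[_ yD]].
  by rewrite 2!inE yD.
have A00 : A0 != set0 by apply/set0Pn; exists x.
have EF0 : E :|: F != set0 by apply/set0Pn; exists b.
have [K avK leK] := periodic_avoid A00 EF0 av0.
have xbC := avK x b xA0 bEF.
have properC : sumset S K != [set: G] by apply: contraNneq xbC => ->; rewrite inE.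
(* Since x + b lies in D but not in S + K, the bound k + |K| <= |S + K| applies, and K cancels from
   [leK]. *)
have nDC : ~~ (D \subset sumset S K).
  by apply/subsetPn; exists (x + b)%R => //; case/setIdP: bE.
have leKC := card_sumset_incomparable properC nDC.
have cEF := cardsUI E F; rewrite dEF cards0 cF in cEF.
have := cardsC D; rewrite -cardsT /fiber -/A0; lia.
Qed.

Lemma card_neighbors A B x :
    {in A & B, forall a b, (a + b)%R \notin S} -> x \in A ->
  #|S| + #|[set y in B | (x + y)%R \in D]| <= #|D|.
Proof.
move=> avS xA; rewrite -(cardsID S D) (setIidPr (sub_sumset S H)) leq_add2l.
by apply: (@leq_card_translate _ _ _ x) => y /setIdP[yB yD]; rewrite inE avS.
Qed.

Definition cut A B :=
  [/\ A != set0, B != set0, [disjoint A & B] &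
      {in A & B, forall a b, (a + b)%R \notin S}].

Lemma cutC A B : cut A B -> cut B A.
Proof.
case=> A0 B0 dAB avS; split=> // [|b a bB aA]; first by rewrite disjoint_sym.
by rewrite addrC avS.
Qed.

(** Assuming equality, x and y are taken in the fullest cosets of A and B. Summing [bound] over t <
    h gives [le_AB], which is too large for the parts of B in D - x and of A in D - y. *)
Lemma card_cut_lt A B :
    (forall A' B', cut A' B' -> k + #|A'| + #|B'| <= #|[set: G]|) ->
  cut A B -> k + #|A| + #|B| < #|[set: G]|.
Proof.
move=> le_cut cutAB; rewrite ltn_neqAle le_cut // andbT; apply/eqP=> eAB.
have [/set0Pn[a0 a0A] /set0Pn[b0 b0B] dAB avS] := cutAB.
have [_ _ _ avS'] := cutC cutAB.
pose h := #|H|.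
have perD : periodic H D by apply: periodic_sumset.
have [x xA maxA] := arg_maxnP (fun x => fiber H A x) a0A.
have [y yB maxB] := arg_maxnP (fun x => fiber H B x) b0B.
set mA := fiber H A x in maxA *; set mB := fiber H B y in maxB *.
pose Dx : {set G} := [set z | (x + z)%R \in D]; pose Dy : {set G} := [set z | (y + z)%R \in D].
pose U t := [set z | t < fiber H A z]; pose V t := [set z | h - t <= fiber H B z].
have h_le : h <= #|~: D|.
  have [z] : exists z, z \in ~: D by apply/set0Pn; rewrite -subset0 -setCT setCS subTset.
  by apply: periodic_leq_card; apply: periodicC.
have perDz z : periodic H [set w | (z + w)%R \in D].
  by move=> u v; rewrite !inE addrA; apply: perD.
have cDz z : #|~: [set w | (z + w)%R \in D]| <= #|~: D|.
  by apply: (@leq_card_translate _ _ _ z) => u; rewrite !inE.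
have fib0 E z : fiber H E z != 0 -> exists2 e, e \in E & fiber H E e = fiber H E z.
  rewrite -lt0n => /card_gt0P[e /setIdP[eE ezH]]; exists e => //.
  by rewrite -(fiberD E z ezH) addrC subrK.
(* The indicator marks the levels where [U t] and [V t] are both empty; there h <= |~: D| leaves
   room. If just one is nonempty, its part outside [Dx] or [Dy] has size at most |~: D|. *)
have bound t : t < h ->
    #|U t| + #|V t| + h * (mA <= t < h - mB) <= #|~: D| + #|V t :&: Dx| + #|U t :&: Dy|.
  move=> lt_th.
  have perU : periodic H (U t) by move=> u v; rewrite !inE => + vH; rewrite fiberD.
  have perV : periodic H (V t) by move=> u v; rewrite !inE => + vH; rewrite fiberD.
  have splitV := leq_trans (subset_leq_card (subsetIr (V t) (~: Dx))) (cDz x).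
  have splitU := leq_trans (subset_leq_card (subsetIr (U t) (~: Dy))) (cDz y).
  have cV := cardsID Dx (V t); rewrite setDE in cV.
  have cU := cardsID Dy (U t); rewrite setDE in cU.
  have maxU u : u \in U t -> t < mA.
    rewrite inE => lt_tu; have [|a aA ea] := fib0 A u; first by lia.
    by apply: leq_trans lt_tu _; rewrite -ea; apply: maxA.
  have maxV v : v \in V t -> h - t <= mB.
    rewrite inE => le_tv; have [|b bB eb] := fib0 B v; first by lia.
    by apply: leq_trans le_tv _; rewrite -eb; apply: maxB.
  have [U0|[u uU]] := set_0Vmem (U t); have [V0|[v vV]] := set_0Vmem (V t).
  - rewrite U0 V0 !set0I !cards0; case: (_ <= _ < _); lia.
  - have -> : (mA <= t < h - mB) = false by have := maxV v vV; lia.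
    rewrite U0 set0I cards0 [h * _]muln0; lia.
  - have -> : (mA <= t < h - mB) = false by have := maxU u uU; lia.
    rewrite V0 set0I cards0 [h * _]muln0; lia.
  have -> : (mA <= t < h - mB) = false by have := maxU u uU; lia.
  rewrite [h * _]muln0 addn0.
  have cutUV : cut (U t) (V t).
    split; [by apply/set0Pn; exists u | by apply/set0Pn; exists v | |].
      rewrite disjoint_subset; apply/subsetP=> z; rewrite !inE => ltA.
      apply/negP=> leB.
      pose P := [set a in A | (a - z)%R \in H]; pose Q := [set b in B | (b - z)%R \in H].
      have dPQ : #|P :&: Q| = 0.
        apply: eq_card0 => w; apply/negP=> /setIP[/setIdP[wA _] /setIdP[wB _]].
        by rewrite (disjointFr dAB wA) in wB.
      have := cardsUI P Q; rewrite dPQ.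
      have : #|P :|: Q| <= h.
        apply: (@leq_card_translate _ _ _ (- z)%R) => w; rewrite addrC.
        by case/setUP=> /setIdP[].
      rewrite /fiber -/P in ltA; rewrite /fiber -/Q in leB; lia.
    move=> w z; rewrite !inE => ltA leB; apply/negP=> wzS.
    have wzD : (w + z)%R \in sumset S H by apply: (subsetP (sub_sumset S H)).
    have lt_h : #|H| < fiber H A w + fiber H B z by rewrite -/h; lia.
    have [a [b [aA bB]]] := fiber_pigeonhole wzD lt_h.
    by rewrite (negPf (avS a b aA bB)).
  have := le_cut _ _ cutUV; rewrite cardsT -(cardsC D) -/h => leUV.
  have /dvdnP[n1 e1] := periodic_dvdn perU; have /dvdnP[n2 e2] := periodic_dvdn perV.
  have /dvdnP[n3 e3] := periodic_dvdn (periodicC perD).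
  (* As |D| < k + h, the cut has total size below |~: D| + h; divisibility by h lowers this to |~:
     D|. *)
  have : (n1 + n2) * h < n3.+1 * h by rewrite mulSn mulnDl /h -e1 -e2 -e3; lia.
  rewrite ltn_mul2r ltnS => /andP[_]; rewrite -(leq_pmul2r (cardG_gt0 H)) mulnDl -e1 -e2 -e3.
  by lia.
have perT : periodic H [set: G] by move=> u v; rewrite !inE.
have sumA : \sum_(t < h) #|U t| = h * #|A|.
  rewrite -[A in RHS]setIT; apply: etrans (sum_superlevel_fiber A perT).
  by apply: eq_bigr => t _; apply: eq_card => z; rewrite !inE.
have sumB : \sum_(t < h) #|V t| = h * #|B|.
  rewrite -[B in RHS]setIT; apply: etrans (sum_superlevel_fiber_rev B perT).
  by apply: eq_bigr => t _; apply: eq_card => z; rewrite !inE.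
have sumBx : \sum_(t < h) #|V t :&: Dx| = h * #|B :&: Dx|.
  apply: etrans (sum_superlevel_fiber_rev B (perDz x)).
  by apply: eq_bigr => t _; rewrite setIC; apply: eq_card => z; rewrite !inE.
have sumAy : \sum_(t < h) #|U t :&: Dy| = h * #|A :&: Dy|.
  apply: etrans (sum_superlevel_fiber A (perDz y)).
  by apply: eq_bigr => t _; rewrite setIC; apply: eq_card => z; rewrite !inE.
have le_AB : #|A| + #|B| + (minn h (h - mB) - mA) <=
    #|~: D| + #|B :&: Dx| + #|A :&: Dy|.
  rewrite -(leq_pmul2l (cardG_gt0 H)) -/h !mulnDr -sumA -sumB -sumBx -sumAy.
  rewrite -sum_ord_interval big_distrr /= -[h in h * _]card_ord -sum_nat_const.
  by rewrite -!big_split; apply: leq_sum => t _; apply: bound.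
have setE (E : {set G}) z : [set w in E | (z + w)%R \in D] = E :&: [set w | (z + w)%R \in D].
  by apply/setP=> w; rewrite !inE.
have eA1 := card_neighbors_fiber avS xA; have eA2 := card_neighbors avS xA.
have eB1 := card_neighbors_fiber avS' yB; have eB2 := card_neighbors avS' yB.
rewrite !setE -/Dx -/Dy -/mA -/mB in eA1 eA2 eB1 eB2.
have := cardsC D; rewrite -cardsT.
(* If both parts are nonempty, the fiber bounds give k + h <= |D|, against [lt_Dk]; otherwise [eA2]
   or [eB2] contradicts k < |S|. *)
case: eA1 => [A0|eA1]; case: eB1 => [B0|eB1]; rewrite ?A0 ?B0 ?cards0 in le_AB; lia.
Qed.

End MinimalSubgroup.

Theorem theorem3 (G : finZmodType) (S : {set G})
    (hS : S \proper [set: G])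
    (hk : kappa (add_cayley S) < #|S|) :
  is_min
    (fun n : nat => exists2 H : {group G},
       sumset S H != [set: G] & n = #|sumset S H| - #|H|)
    (kappa (add_cayley S)).
Proof.
set k := kappa _ in hk *.
have S_neq0 : S != set0 by rewrite -card_gt0; lia.
have ltSG := proper_card hS.
have lt_kG : k.+1 < #|{: G}| by rewrite -cardsT; lia.
have le_cut A B : cut S A B -> k + #|A| + #|B| <= #|[set: G]|.
  by case=> A0 B0 dAB avS; rewrite cardsT; apply: kappa_cut.
have [A [B [A0 B0 dAB avS eAB]]] := ex_kappa_cut lt_kG.
have cutAB : cut S A B by [].
have le_k (H : {group G}) : sumset S H != [set: G] -> k <= #|sumset S H| - #|H|.
  move=> properD; rewrite leqNgt; apply/negP=> ltk.
  (* A violation in additive form; the truncated difference is exact because S is nonempty. *)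
  pose P (K : {group G}) :=
    (sumset S K != [set: G]) && (#|sumset S K| < k + #|K|).
  have PH : P H by rewrite /P properD; have := leq_card_sumset H S_neq0; lia.
  have [K /andP[properK ltK] minK] := arg_minnP (fun K : {group G} => #|K|) PH.
  have minK' (L : {group G}) : sumset S L != [set: G] -> #|sumset S L| < k + #|L| -> #|K| <= #|L|.
    by move=> properL ltL; apply: minK; rewrite /P properL ltL.
  have := card_cut_lt hk properK ltK minK' le_cut cutAB.
  by rewrite cardsT -eAB ltnn.
split; last by move=> _ [H properD ->]; apply: le_k.
have [K avK leK] := periodic_avoid A0 B0 avS.
have properK : sumset S K != [set: G].
  have [a aA] := set0Pn _ A0; have [b bB] := set0Pn _ B0.
  by apply: contraNneq (avK a b aA bB) => ->; rewrite inE.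
exists K => //; apply/eqP; rewrite eqn_leq le_k // andTb.
by rewrite cardsT -eAB -/k in leK; lia.
Qed.
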